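(* Let $P$ be a finite poset of rank at most three. Then for any $d\ge1$, the poset $P^{(d)}$ defined in the context satisfies: (1c) If $P$ has a unique minimal element, then $P^{(d)}$ has a unique minimal element. (2c) $\operatorname{rank}(P)=\operatorname{rank}(P^{(d)})$. (3c) $|M_{md}(P)|=|M_m(P^{(d)})|$ for all $m\ge1$.
   Context: All posets are finite. The length of a chain is the cardinality of its underlying set. The rank of a poset is the supremum of the lengths of its chains. The height of $\alpha\in P$ is $\operatorname{ht}(\alpha)=\sup\{\text{length of chains in } P \text{ with largest element }\alpha\}-1$. For $m\ge1$, an $m$-multichain in a poset $P$ is a weakly increasing sequence $\alpha_1\le\cdots\le\alpha_m$ of $m$ elements of $P$, and $M_m(P)$ denotes the set of $m$-multichains in $P$. **The poset $P^{(d)}$.** Let $P$ be a poset of rank at most three. The elements of $P^{(d)}$ are the $d$-multichains $\alpha=(\alpha_1,\ldots,\alpha_d)$ in $P$. For such an $\alpha$ put $$v(\alpha)=(\operatorname{ht}(\alpha_1),\operatorname{ht}(\alpha_2)-\operatorname{ht}(\alpha_1),\ldots,\operatorname{ht}(\alpha_d)-\operatorname{ht}(\alpha_{d-1})).$$ For $d$-multichains $\alpha,\beta$, set $\alpha\le\beta$ in $P^{(d)}$ if and only if (1) the set $\{\alpha_1,\ldots,\alpha_d,\beta_1,\ldots,\beta_d\}$ is totally ordered in $P$, and (2) $v(\alpha)\le v(\beta)$ component-wise. (This is a partial order when $P$ has rank at most three.) *)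

(* Defs.v *)
From HB Require Import structures.
From mathcomp Require Import all_boot all_order.
From mathcomp Require Import zify.

Set Implicit Arguments.
Unset Strict Implicit.
Unset Printing Implicit Defensive.

Import Order.TTheory.
Local Open Scope order_scope.

Section FinitePosets.
Context {disp : Order.disp_t} {P : finPOrderType disp}.
Implicit Types (x y : P) (C : {set P}).

Definition is_chain C : bool := [forall x in C, forall y in C, x >=< y].

(* The length of a chain is its number of elements, not of covering steps. *)
Definition rank_of : nat := (\max_(C : {set P} | is_chain C) #|C|)%N.

Definition chain_with_top x C : bool :=
  [&& is_chain C, x \in C & [forall y in C, y <= x]].

Definition ht x : nat :=
  ((\max_(C : {set P} | chain_with_top x C) #|C|) - 1)%N.

Definition minimal x : Prop := forall y, y <= x -> y = x.

Lemma is_chainP C :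
  reflect (forall x y, x \in C -> y \in C -> x >=< y) (is_chain C).
Proof.
apply: (iffP forall_inP) => [cC x y xC yC|cC x xC].
  by have /forall_inP := cC x xC; apply.
by apply/forall_inP => y yC; apply: cC.
Qed.

Lemma chain_with_top1 x : chain_with_top x [set x].
Proof.
apply/and3P; split; last by apply/forall_inP => y /set1P ->.
  by apply/is_chainP => y z /set1P -> /set1P ->; apply: comparablexx.
by rewrite set11.
Qed.

Lemma ht_witness x : exists2 C, chain_with_top x C & #|C| = (ht x).+1.
Proof.
have := @eq_bigmax_cond _ (chain_with_top x) (fun C : {set P} => #|C|).
case=> [|C hC EC]; first by apply/card_gt0P; exists [set x]; exact: chain_with_top1.
exists C => //; rewrite /ht EC subn1 prednK //.
by case/and3P: hC => _ xC _; apply/card_gt0P; exists x.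
Qed.

Lemma leq_ht x C : chain_with_top x C -> (#|C| <= (ht x).+1)%N.
Proof.
move=> hC; rewrite /ht subn1.
by apply: leq_trans (leqSpred _); apply: leq_bigmax_cond.
Qed.

Lemma ht_lt_rank x : (ht x < rank_of)%N.
Proof.
have [C /and3P[cC _ _] <-] := ht_witness x.
exact: leq_bigmax_cond.
Qed.

Lemma ht_lt x y : x < y -> (ht x < ht y)%N.
Proof.
move=> xy; have [C /and3P[/is_chainP cC xC /forall_inP topC] EC] := ht_witness x.
have ltC z : z \in C -> z < y by move=> zC; apply: le_lt_trans (topC _ zC) xy.
have yC : y \notin C by apply/negP => /ltC; rewrite ltxx.
suff /leq_ht : chain_with_top y (y |: C) by rewrite cardsU1 yC EC.
apply/and3P; split; last 1 first.
- by apply/forall_inP => z /setU1P[->|/ltC/ltW].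
- apply/is_chainP => u v /setU1P[->|uC] /setU1P[->|vC].
  + exact: comparablexx.
  + by rewrite comparable_sym; apply/lt_comparable/ltC.
  + by apply/lt_comparable/ltC.
  + exact: cC.
- by rewrite setU11.
Qed.

Lemma ht_le x y : x <= y -> (ht x <= ht y)%N.
Proof. by rewrite le_eqVlt => /predU1P[->//|/ht_lt/ltnW]. Qed.

Lemma comparable_ht_le x y : x >=< y -> (ht x <= ht y)%N -> x <= y.
Proof. by case/comparable_ltgtP => // /ht_lt; lia. Qed.

End FinitePosets.

Arguments rank_of {disp} P.

Section Multichains.
Context {disp : Order.disp_t}.

Record multichain (m : nat) (P : finPOrderType disp) : predArgType :=
  Multichain { mc_tuple :> m.-tuple P; mc_sorted : sorted <=%O mc_tuple }.

HB.instance Definition _ m P := [isSub for @mc_tuple m P].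
HB.instance Definition _ m P := [Finite of multichain m P by <:].

Variables (d : nat) (P : finPOrderType disp).
Implicit Types a b c : multichain d P.

(* [pairmap] starts from 0, so the first entry is the height of the first
   element; the truncated subtractions are exact, since heights increase along
   a multichain ([ht_le]). *)
Definition ht_steps a : d.-tuple nat :=
  [tuple of pairmap (fun h h' : nat => (h' - h)%N) 0%N (map ht a)].

Definition multichain_le a b : bool :=
  all2rel >=<%O (a ++ b)
  && [forall i, (tnth (ht_steps a) i <= tnth (ht_steps b) i)%N].

Lemma mc_le_tnth a (i j : 'I_d) : (i <= j)%N -> tnth a i <= tnth a j.
Proof.
have tE := tnth_nth (tnth a i); rewrite (tE _ _ i) (tE _ _ j) => ij.
apply: (sorted_leq_nth le_trans (@lexx _ _) _ (mc_sorted a)) => //;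
  by rewrite inE size_tuple.
Qed.

Lemma mc_comparable a (i j : 'I_d) : tnth a i >=< tnth a j.
Proof.
case: (leqP i j) => [|/ltnW] /(mc_le_tnth a) h; first exact: le_comparable.
exact: ge_comparable.
Qed.

Lemma multichain_le_comparable a b :
  all2rel >=<%O (a ++ b) <-> forall i j, tnth a i >=< tnth b j.
Proof.
split=> [/allrelP h i j|h].
  by apply: h; rewrite mem_cat mem_tnth ?orbT.
apply/allrelP => x y; rewrite !mem_cat.
case/orP=> /tnthP[i ->] /orP[] /tnthP[j ->];
  rewrite ?mc_comparable ?h //.
by rewrite comparable_sym.
Qed.

Lemma ht_stepsE a (i : 'I_d) :
  tnth (ht_steps a) i =
    (ht (tnth a i) - (if val i is k.+1 then nth 0%N (map ht a) k else 0))%N.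
Proof.
rewrite (tnth_nth 0%N) /= (nth_pairmap 0%N) ?size_map ?size_tuple //.
rewrite -(tnth_map ht) (tnth_nth 0%N) /=.
by case: (val i).
Qed.

Lemma ht_steps_le a b :
  [forall i, (tnth (ht_steps a) i <= tnth (ht_steps b) i)%N] ->
  (forall i : 'I_d, (ht (tnth a i) <= ht (tnth b i))%N) /\
  (forall i j : 'I_d, (i <= j)%N ->
     (ht (tnth a j) + ht (tnth b i) <= ht (tnth b j) + ht (tnth a i))%N).
Proof.
move=> /forallP steps.
have main (i j : 'I_d) : (i <= j)%N ->
    (ht (tnth a j) + ht (tnth b i) <= ht (tnth b j) + ht (tnth a i))%N.
  case: j => j; elim: j => [|j IH] hj ij.
    have -> : i = Ordinal hj by apply: val_inj => /=; move: ij => /=; lia.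
    by rewrite addnC.
  have [ij'|ij'] := leqP i j; last first.
    have -> : i = Ordinal hj by apply: val_inj => /=; move: ij => /=; lia.
    by rewrite addnC.
  have hj' : (j < d)%N by exact: ltnW hj.
  have := IH hj' ij'; have := steps (Ordinal hj); rewrite !ht_stepsE /=.
  have nthE c : nth 0%N (map ht c) j = ht (tnth c (Ordinal hj')).
    by rewrite -(tnth_map ht) (tnth_nth 0%N).
  rewrite !nthE.
  have jj : (Ordinal hj' <= Ordinal hj)%N by rewrite /=.
  have := ht_le (mc_le_tnth a jj); have := ht_le (mc_le_tnth b jj).
  by lia.
split=> // i; have d0 : (0 < d)%N by apply: leq_ltn_trans (ltn_ord i).
have := main (Ordinal d0) i isT; have := steps (Ordinal d0).
rewrite !ht_stepsE /=; by lia.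
Qed.

Lemma multichain_le_refl : reflexive multichain_le.
Proof.
move=> a; apply/andP; split; last exact/forallP.
by apply/multichain_le_comparable => i j; apply: mc_comparable.
Qed.

Lemma multichain_le_tnth a b i : multichain_le a b -> tnth a i <= tnth b i.
Proof.
move=> /andP[/multichain_le_comparable cab /ht_steps_le[hab _]].
exact: comparable_ht_le.
Qed.

Lemma multichain_le_anti : antisymmetric multichain_le.
Proof.
move=> a b /andP[ab ba]; apply/val_inj/eq_from_tnth => i.
by apply: le_anti; rewrite !multichain_le_tnth.
Qed.

Lemma multichain_le_trans :
  (rank_of P <= 3)%N -> transitive multichain_le.
Proof.
move=> rankP b a c ab bc.
have /andP[/multichain_le_comparable cab sab] := ab.
have /andP[/multichain_le_comparable cbc sbc] := bc.
apply/andP; split; last first.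
  apply/forallP => i; exact: leq_trans (forallP sab i) (forallP sbc i).
apply/multichain_le_comparable => i j.
have [_ dab] := ht_steps_le sab; have [_ dbc] := ht_steps_le sbc.
have aibi := multichain_le_tnth i ab; have ajbj := multichain_le_tnth j ab.
have bici := multichain_le_tnth i bc; have bjcj := multichain_le_tnth j bc.
have [ij|/ltnW ji] := leqP i j.
  exact/le_comparable/(le_trans aibi)/(le_trans bici)/mc_le_tnth.
have {}dab := dab _ _ ji; have {}dbc := dbc _ _ ji.
have hci : (ht (tnth c i) < 3)%N by apply: leq_trans (ht_lt_rank _) rankP.
case: (comparable_leP (cab i j)) => [aibj|bjai].
  exact/le_comparable/(le_trans aibj).
case: (comparable_leP (cbc i j)) => [bicj|cjbi].
  exact/le_comparable/(le_trans aibi).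
move: (aibi); rewrite le_eqVlt => /predU1P[->|/ht_lt h1]; first exact: cbc.
move: (bjcj); rewrite le_eqVlt => /predU1P[<-|/ht_lt h2]; first exact: cab.
have := ht_lt bjai; have := ht_lt cjbi; have := ht_le ajbj; have := ht_le bici.
by lia.
Qed.

End Multichains.

(* The bound on the rank is what makes [multichain_le] transitive, so its proof
   is a (phantom) parameter of the carrier, which can then bear the order. *)
Definition multichain_poset (disp : Order.disp_t) (P : finPOrderType disp)
  (rankP : (rank_of P <= 3)%N) (d : nat) : predArgType := multichain d P.

Section MultichainPoset.
Context {disp : Order.disp_t} {P : finPOrderType disp}.
Variables (rankP : (rank_of P <= 3)%N) (d : nat).

HB.instance Definition _ := Finite.copy (multichain_poset rankP d) (multichain d P).
HB.instance Definition _ := Order.Le_isPOrder.Build disp (multichain_poset rankP d)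
  (@multichain_le_refl _ d P) (@multichain_le_anti _ d P)
  (multichain_le_trans (d := d) rankP).

Lemma multichain_posetE (a b : multichain_poset rankP d) :
  (a <= b) = multichain_le (a : multichain d P) b.
Proof. by []. Qed.

End MultichainPoset.

(* Main.v *)
Require Import Defs.
From mathcomp Require Import all_boot all_order.
From mathcomp Require Import zify.

(** Throughout, heights stand for elements: inside one chain of [P], two elements
    of the same height are equal and the order can be read off the heights
    ([comparable_ht_inj], [comparable_ht_le]).

    Write [top a] for the largest entry of a d-multichain [a].  Its height is the
    sum of the vector [ht_steps a], so [top] is strictly increasing on P^(d)
    ([multichain_lt_top]).  In the other direction, x |-> (x, ..., x) embeds [P]
    in P^(d), as the vector of (x, ..., x) is (ht x, 0, ..., 0).  A strictly
    increasing map carries chains injectively to chains, hence the equality of the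
    ranks.  If [P] has a unique minimal element x, then x is below everything and
    (x, ..., x) is below everything in P^(d).

    For the count, the point is that the up-set of [a] in P^(d) depends on [a] only
    through [top a].  More precisely, there is a bijection that preserves [top]
    between the multichains [b] above [a] in P^(d) and the d-multichains [c] of [P]
    with [top a <= c_0] ([sum_slide]); it is given, on heights, by
      ht c_i = ht b_i - ht a_i + ht (top a),
    so that the nonnegative increments of [ht_steps] from [a] to [b], listed from
    left to right, become the increments along the sequence that starts at
    [top a] and goes on with [c].
    What has to be seen is that the prescribed height is that of an element of the
    chain formed by [a] and [b] (resp. [a] and [c]); this is where the rank
    comes in ([ht_up], [ht_down]).  Iterating the bijection n times, the number of
    ways to prolong [a] by n elements of P^(d) is the number of ways to prolong
    [top a] by n * d elements of [P] ([extensions_top]).  Summing over the first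
    term [a] of an n.+1-multichain of P^(d) gives the result. *)

Set Implicit Arguments.
Unset Strict Implicit.
Unset Printing Implicit Defensive.

Import Order.TTheory.
Local Open Scope order_scope.

(** * Chains, heights and minimal elements *)

Section Chains.
Context {disp : Order.disp_t}.

Lemma comparable_ht_inj (P : finPOrderType disp) (x y : P) :
  x >=< y -> ht x = ht y -> x = y.
Proof. by case/comparable_ltgtP => // /ht_lt; lia. Qed.

Lemma rank_of_homo (P Q : finPOrderType disp) (f : P -> Q) :
  {homo f : x y / x < y} -> (rank_of P <= rank_of Q)%N.
Proof.
move=> f_lt; apply/bigmax_leqP => C /is_chainP cC.
have f_inj : {in C &, injective f}.
  move=> x y xC yC; case/comparable_ltgtP: (cC x y xC yC) => // /f_lt lt_f eq_f;
    by rewrite eq_f ltxx in lt_f.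
rewrite -(card_in_imset f_inj); apply: leq_bigmax_cond.
apply/is_chainP => _ _ /imsetP[x xC ->] /imsetP[y yC ->].
case/comparable_ltgtP: (cC x y xC yC) => [/f_lt|/f_lt|->].
- exact: lt_comparable.
- exact: gt_comparable.
- exact: comparablexx.
Qed.

(** By finiteness; this turns a unique minimal element into a least element. *)
Lemma minimal_below (P : finPOrderType disp) (y : P) :
  exists2 x, minimal x & x <= y.
Proof.
have [n] := ubnP (ht y); elim: n y => // n IH y hy.
have [/existsP[z zy]|/existsPn no_z] := boolP [exists z, z < y].
  have [|x minx xz] := IH z; first by have := ht_lt zy; lia.
  by exists x => //; apply: le_trans xz (ltW zy).
exists y => // z; rewrite le_eqVlt => /predU1P[//|zy].
by have := no_z z; rewrite zy.
Qed.

End Chains.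

(** * Counting multichains by their initial segments *)

Section CountTuples.

(** The sequence [s] is the initial segment of length [d]; for [sorted] and [path]
    the condition left on [t] involves only the last term of [s]. *)
Lemma card_tuple_cat (T : finType) (d n : nat) (p : pred (seq T))
    (q : seq T -> pred (seq T)) :
    (forall s t, size s = d -> p (s ++ t) = p s && q s t) ->
  #|[pred t : (d + n).-tuple T | p t]| =
    (\sum_(s : d.-tuple T | p s) #|[pred t : n.-tuple T | q s t]|)%N.
Proof.
move=> p_cat; under eq_bigr => s _ do rewrite -sum1_card.
rewrite pair_big_dep -sum1_card /=.
pose join (u : d.-tuple T * n.-tuple T) := cat_tuple u.1 u.2.
have inj_join : injective join.
  move=> [s t] [s' t'] /(congr1 val) /= /eqP.
  by rewrite eqseq_cat ?size_tuple // => /andP[/eqP/val_inj -> /eqP/val_inj ->].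
have bij_join : bijective join.
  by apply: inj_card_bij inj_join _; rewrite card_prod !card_tuple expnD.
rewrite (reindex join) /=; last exact: onW_bij.
by apply: eq_bigl => -[s t]; rewrite !inE /= p_cat ?size_tuple.
Qed.

Lemma big_tuple1 (T : finType) (p : pred (seq T)) (F : 1.-tuple T -> nat) :
  (\sum_(s : 1.-tuple T | p s) F s = \sum_(x : T | p [:: x]) F [tuple x])%N.
Proof.
rewrite (reindex (fun x : T => [tuple x])) //=.
exists (fun s => thead s) => [x _|s _]; first by rewrite theadE.
by apply: val_inj; case/tupleP: s => x t; rewrite theadE /= (tuple0 t).
Qed.

Context {disp : Order.disp_t}.
Implicit Types P : finPOrderType disp.

Definition extensions P n (x : P) : nat :=
  #|[pred t : n.-tuple P | path <=%O x t]|.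

Lemma extensions0 P (x : P) : extensions 0 x = 1%N.
Proof.
rewrite /extensions -(expn0 #|P|) -card_tuple.
by apply: eq_card => t; rewrite !inE tuple0.
Qed.

Lemma last_tnth (T : Type) d (a : d.+1.-tuple T) x : last x a = tnth a ord_max.
Proof. by rewrite (tnth_nth x) -nth_last size_tuple. Qed.

Lemma path_tnth P d (a : d.+1.-tuple P) x :
  path <=%O x a = sorted <=%O a && (x <= tnth a ord0).
Proof. by case/tupleP: a => y t; rewrite tnth0 /= andbC. Qed.

Lemma big_multichain P d (p : pred (d.-tuple P)) (F : d.-tuple P -> nat) :
  (\sum_(t : d.-tuple P | sorted <=%O t && p t) F t =
   \sum_(a : multichain d P | p a) F a)%N.
Proof.
rewrite (reindex_omap (@mc_tuple _ d P) insub) => [|t /andP[t_sorted _]];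
  last by rewrite insubT.
by apply: eq_bigl => a; rewrite mc_sorted valK eqxx andbT.
Qed.

Lemma extensionsD P d n (x : P) :
  extensions (d.+1 + n) x =
    (\sum_(a : multichain d.+1 P | (x <= tnth a ord0)%O)
       extensions n (tnth a ord_max))%N.
Proof.
rewrite [LHS](@card_tuple_cat P _ n (path <=%O x)
    (fun s => path <=%O (last x s)));
  last by move=> s t _; rewrite cat_path.
rewrite -(big_multichain (fun s => x <= tnth s ord0)
                         (fun s => extensions n (tnth s ord_max))).
by apply: eq_big => [s|s _]; rewrite ?path_tnth // last_tnth.
Qed.

Lemma extensionsS P n (x : P) :
  extensions n.+1 x = (\sum_(y | (x <= y)%O) extensions n y)%N.
Proof.
rewrite -add1n [LHS](@card_tuple_cat P _ n (path <=%O x)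
    (fun s => path <=%O (last x s)));
  last by move=> s t _; rewrite cat_path.
by rewrite (big_tuple1 (path _ x)); apply: eq_bigl => y /=; rewrite andbT.
Qed.

(** The initial segment must be nonempty, for its last term to bound the rest. *)
Lemma card_sorted_cat P d n :
  #|[pred t : (d.+1 + n).-tuple P | sorted <=%O t]| =
    (\sum_(s : d.+1.-tuple P | sorted <=%O s) extensions n (tnth s ord_max))%N.
Proof.
rewrite (@card_tuple_cat P _ n (sorted <=%O)
  (fun s t => if s is x :: s' then path <=%O (last x s') t else true));
  last by move=> [|x s] t //= _; rewrite cat_path.
apply: eq_bigr => s _; congr #|pred_of_simpl _|.
by case/tupleP: s => x s; rewrite -(last_tnth _ x).
Qed.

Lemma card_multichainD P d n :
  #|{: multichain (d.+1 + n) P}| =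
    (\sum_(a : multichain d.+1 P) extensions n (tnth a ord_max))%N.
Proof.
rewrite card_sub [LHS]card_sorted_cat.
rewrite -(big_multichain xpredT (fun s => extensions n (tnth s ord_max))).
by apply: eq_bigl => s; rewrite andbT.
Qed.

Lemma card_multichainS P n :
  #|{: multichain n.+1 P}| = (\sum_(x : P) extensions n x)%N.
Proof. by rewrite card_sub [LHS](card_sorted_cat P 0) big_tuple1. Qed.

End CountTuples.

(** * The up-set of a multichain in P^(d) *)

Section Interval.
Context {disp : Order.disp_t} {P : finPOrderType disp}.
Variable d : nat.
Implicit Types a b c : multichain d.+1 P.

Local Notation top a := (tnth a ord_max).

(** An inequality between consecutive differences of heights is additive, so it
    holds between any two positions; this form avoids truncated subtraction. *)
Lemma multichain_leP a b :
  reflect [/\ forall i j, tnth a i >=< tnth b j,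
              (ht (tnth a ord0) <= ht (tnth b ord0))%N &
              forall i j : 'I_d.+1, (i <= j)%N ->
     (ht (tnth a j) + ht (tnth b i) <= ht (tnth b j) + ht (tnth a i))%N]
   (multichain_le a b).
Proof.
apply: (iffP andP) => [[/multichain_le_comparable cab /ht_steps_le[le0 le_ab]]|].
  by split.
case=> cab le0 le_ab; split; first exact/multichain_le_comparable.
apply/forallP => -[i lt_i]; rewrite !ht_stepsE /=.
case: i lt_i => [|i] lt_i.
  by rewrite (_ : Ordinal lt_i = ord0) ?subn0 //; exact: val_inj.
have nthE c : nth 0%N (map ht c) i = ht (tnth c (Ordinal (ltnW lt_i))).
  by rewrite -(tnth_map ht) (tnth_nth 0%N).
by rewrite !nthE; have /= := le_ab (Ordinal (ltnW lt_i)) (Ordinal lt_i) (leqnSn _); lia.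
Qed.

Lemma sorted_ht (t : d.+1.-tuple P) :
    (forall i j : 'I_d.+1, tnth t i >=< tnth t j) ->
    (forall i j : 'I_d.+1, (i <= j)%N -> (ht (tnth t i) <= ht (tnth t j))%N) ->
  sorted <=%O t.
Proof.
(* The default value of [nth] must be opaque: it is itself an entry of [t]. *)
move=> ct ht_t; have [x0 _] : exists x0, x0 = thead t by exists (thead t).
apply/(sortedP x0) => i; rewrite size_tuple => lt_i.
have := ht_t (Ordinal (ltnW lt_i)) (Ordinal lt_i) (leqnSn i).
by move/(comparable_ht_le (ct _ _)); rewrite !(tnth_nth x0).
Qed.

Lemma eq_from_tnth_mc a b : (forall i, tnth a i = tnth b i) -> a = b.
Proof. by move=> eq_ab; apply/val_inj/eq_from_tnth. Qed.

Lemma mc_le_top a i : tnth a i <= top a.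
Proof. by apply: mc_le_tnth; apply: leq_ord. Qed.

(** The heights of [b] exceed those of [a] by an amount that increases weakly
    with the position; if it is zero at the top, it is zero everywhere. *)
Lemma multichain_lt_top a b : multichain_le a b -> a != b -> top a < top b.
Proof.
move=> le_ab; rewrite lt_neqAle multichain_le_tnth // andbT; apply: contra_neq => eq_t.
have [cab _ step] := multichain_leP _ _ le_ab.
apply: eq_from_tnth_mc => i; apply: comparable_ht_inj => //.
have := step i ord_max (leq_ord i); rewrite eq_t.
by have := ht_le (multichain_le_tnth i le_ab); lia.
Qed.

Lemma const_sorted (x : P) : sorted <=%O [tuple x | i < d.+1].
Proof. by apply: sorted_ht => i j; rewrite !tnth_mktuple ?comparablexx. Qed.

Definition const_multichain x : multichain d.+1 P := Multichain (const_sorted x).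

Lemma const_multichain_le x b :
  (forall j, x <= tnth b j) -> multichain_le (const_multichain x) b.
Proof.
move=> le_xb; apply/multichain_leP; split=> [i j||i j le_ij];
  rewrite !tnth_mktuple; first exact: le_comparable.
- exact: ht_le.
- by have := ht_le (mc_le_tnth b le_ij); lia.
Qed.

Hypothesis rankP : (rank_of P <= 3)%N.

Lemma ht_le2 (x : P) : (ht x <= 2)%N.
Proof. by have := ht_lt_rank x; lia. Qed.

(** In a chain, the element of height [ht y + ht z - ht x], the fourth vertex of a
    parallelogram on [x], [y], [z].  It is [z] or [y] when one of the two sides at
    [x] is trivial; [w] is the answer supplied for the remaining case. *)
Definition fourth (x y z w : P) : P :=
  if y == x then z else if z == x then y else w.

Lemma ht_fourth (x y z w : P) :
    (x != y -> x != z -> (ht w + ht x = ht y + ht z)%N) ->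
  (ht (fourth x y z w) + ht x = ht y + ht z)%N.
Proof.
rewrite /fourth ![x == _]eq_sym.
have [-> _|_] := eqVneq y x; first by rewrite addnC.
by have [->|_] := eqVneq z x => // /(_ isT isT).
Qed.

Lemma mem_fourth (S : seq P) (x y z w : P) :
  y \in S -> z \in S -> w \in S -> fourth x y z w \in S.
Proof. by rewrite /fourth; do 2?case: ifP. Qed.

(** For [a <= b] in P^(d), transports [b] to a multichain above [top a]: the entry
    [i] has height [ht b_i - ht a_i + ht (top a)].  The default value [a] of
    [insubd] is never reached when [a <= b] ([slide_upE]). *)
Definition slide_up a b : multichain d.+1 P :=
  insubd a [tuple fourth (tnth a i) (tnth b i) (top a) (top b) | i < d.+1].

(** The inverse of [slide_up a]: the entry [i] has height
    [ht b_i - ht (top a) + ht a_i].  Here the three elements satisfy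
    [a_i <= top a <= b_i], so the base point of [fourth] is the middle one. *)
Definition slide_down a b : multichain d.+1 P :=
  insubd a [tuple fourth (top a) (tnth b i) (tnth a i) (top a) | i < d.+1].

Section Up.
Variables a b : multichain d.+1 P.
Hypothesis le_ab : multichain_le a b.

Let up i := fourth (tnth a i) (tnth b i) (top a) (top b).

(** Only the case [a_i < b_i] and [a_i < top a] needs an argument.  There
    [ht (top b) >= ht b_i + ht (top a) - ht a_i], which is at least
    [ht a_i + 2]; as heights are at most 2, the entry [a_i] has height 0, both
    [b_i] and [top a] have height 1, and [top b] has height 2. *)
Lemma ht_up i : (ht (up i) + ht (tnth a i) = ht (tnth b i) + ht (top a))%N.
Proof.
have [cab _ step] := multichain_leP _ _ le_ab.
apply: ht_fourth => ne_b ne_a.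
have lt_b : tnth a i < tnth b i by rewrite lt_neqAle ne_b multichain_le_tnth.
have lt_a : tnth a i < top a by rewrite lt_neqAle ne_a mc_le_top.
have := ht_lt lt_b; have := ht_lt lt_a; have := ht_le2 (top b).
by have := step i ord_max (leq_ord i); lia.
Qed.

Lemma mem_up i : up i \in (a ++ b : seq P).
Proof. by apply: mem_fourth; rewrite mem_cat mem_tnth ?orbT. Qed.

Lemma slide_upE i : tnth (slide_up a b) i = up i.
Proof.
have [_ _ step] := multichain_leP _ _ le_ab; have /andP[/allrelP cab _] := le_ab.
rewrite /slide_up insubdK; first by rewrite tnth_mktuple.
apply: sorted_ht => j k; rewrite !tnth_mktuple -!/(up _).
  by apply: cab; apply: mem_up.
by move/step; have := ht_up j; have := ht_up k; lia.
Qed.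
End Up.

Section Down.
Variables a b : multichain d.+1 P.
Hypothesis le_ab : top a <= tnth b ord0.

Let down i := fourth (top a) (tnth b i) (tnth a i) (top a).

Lemma le_top_down i : top a <= tnth b i.
Proof. by apply: le_trans le_ab _; apply: mc_le_tnth. Qed.

Lemma comparable_down : all2rel >=<%O (a ++ b).
Proof.
apply/multichain_le_comparable => i j.
exact/le_comparable/(le_trans (mc_le_top a i))/le_top_down.
Qed.

(** If [a_i < top a < b_i], these elements have heights 0, 1, 2, and the height
    to be reached is 2 - 1 + 0, that of [top a]. *)
Lemma ht_down i : (ht (down i) + ht (top a) = ht (tnth b i) + ht (tnth a i))%N.
Proof.
apply: ht_fourth => ne_b ne_a.
have lt_b : top a < tnth b i by rewrite lt_neqAle ne_b le_top_down.
have lt_a : tnth a i < top a by rewrite lt_neqAle eq_sym ne_a mc_le_top.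
by have := ht_lt lt_b; have := ht_lt lt_a; have := ht_le2 (tnth b i); lia.
Qed.

Lemma mem_down i : down i \in (a ++ b : seq P).
Proof. by apply: mem_fourth; rewrite mem_cat mem_tnth ?orbT. Qed.

Lemma slide_downE i : tnth (slide_down a b) i = down i.
Proof.
rewrite /slide_down insubdK; first by rewrite tnth_mktuple.
apply: sorted_ht => j k; rewrite !tnth_mktuple -!/(down _).
  by apply: (allrelP comparable_down); apply: mem_down.
move=> le_jk; have := ht_le (mc_le_tnth a le_jk).
by have := ht_le (mc_le_tnth b le_jk); have := ht_down j; have := ht_down k; lia.
Qed.
End Down.

Lemma top_slide_up a b : multichain_le a b -> top (slide_up a b) = top b.
Proof.
move=> le_ab; rewrite slide_upE // /fourth eqxx.
by case: eqP.
Qed.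

Lemma slide_up_ge a b : multichain_le a b -> top a <= tnth (slide_up a b) ord0.
Proof.
move=> le_ab; have /andP[/allrelP cab _] := le_ab.
have [_ h0 _] := multichain_leP _ _ le_ab; rewrite slide_upE //.
apply: comparable_ht_le; last by have := ht_up le_ab ord0; lia.
by apply: cab; rewrite ?mem_up // mem_cat mem_tnth.
Qed.

Lemma slide_down_ge a b : top a <= tnth b ord0 -> multichain_le a (slide_down a b).
Proof.
move=> le_ab; have ht_ab i := ht_down le_ab i; have le_b := ht_le le_ab.
apply/multichain_leP; split=> [i j||i j le_ij]; rewrite ?slide_downE //.
- by apply: (allrelP (comparable_down le_ab)); rewrite ?mem_down // mem_cat mem_tnth.
- by have := ht_ab ord0; lia.
- have := ht_ab i; have := ht_ab j.
  by have := ht_le (mc_le_tnth b le_ij); lia.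
Qed.

(** The composite has the heights of [b] by construction, and its entries lie in the
    chain formed by [a] and [b]; hence it is [b]. *)
Lemma slide_upK a b : multichain_le a b -> slide_down a (slide_up a b) = b.
Proof.
move=> le_ab; have le_u := slide_up_ge le_ab.
have /andP[/allrelP cab _] := le_ab.
apply: eq_from_tnth_mc => i; rewrite slide_downE //; apply: comparable_ht_inj.
  apply: cab; last by rewrite mem_cat mem_tnth orbT.
  by rewrite slide_upE // mem_fourth ?mem_up // mem_cat mem_tnth.
by have := ht_down le_u i; have := ht_up le_ab i; rewrite -(slide_upE le_ab); lia.
Qed.

Lemma slide_downK a b : top a <= tnth b ord0 -> slide_up a (slide_down a b) = b.
Proof.
move=> le_ab; have le_d := slide_down_ge le_ab.
have /allrelP cab := comparable_down le_ab.
apply: eq_from_tnth_mc => i; rewrite slide_upE //; apply: comparable_ht_inj.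
  apply: cab; last by rewrite mem_cat mem_tnth orbT.
  by rewrite !slide_downE // mem_fourth ?mem_down // mem_cat mem_tnth.
by have := ht_up le_d i; have := ht_down le_ab i; rewrite -(slide_downE le_ab); lia.
Qed.

(** The bijection between the two index sets, in the weighted form in which it can
    be iterated: the weight depends on [b] only through its top. *)
Lemma sum_slide a (F : P -> nat) :
  (\sum_(b : multichain d.+1 P | multichain_le a b) F (top b) =
   \sum_(b : multichain d.+1 P | (top a <= tnth b ord0)%O) F (top b))%N.
Proof.
rewrite [RHS](reindex_onto (slide_up a) (slide_down a)) => [|b]; last first.
  exact: slide_downK.
apply: eq_big => [b|b /top_slide_up -> //].
apply/idP/andP => [le_ab|[le_u /eqP<-]]; last exact: slide_down_ge.
by rewrite slide_up_ge // slide_upK.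
Qed.

End Interval.

(** * The theorem *)

(** Both sides satisfy the same recursion in [n]: on the left the next
    element of P^(d) is chosen, on the right the next [d.+1] elements of [P], and
    [sum_slide] matches the choices. *)
Lemma extensions_top (disp : Order.disp_t) (P : finPOrderType disp)
    (rankP : (rank_of P <= 3)%N) d n (a : multichain_poset rankP d.+1) :
  extensions n a = extensions (n * d.+1) (tnth (mc_tuple a) ord_max).
Proof.
elim: n a => [|n IH] a; first by rewrite mul0n !extensions0.
rewrite extensionsS mulSn extensionsD -sum_slide //.
by apply: eq_bigr => b _; exact: IH.
Qed.

Theorem proposition4p4 (disp : Order.disp_t) (P : finPOrderType disp)
    (rankP : (rank_of P <= 3)%N) (d : nat) (d_ge1 : (1 <= d)%N) :
  [/\ (exists! x : P, minimal x) ->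
        exists! a : multichain_poset rankP d, minimal a,
      rank_of P = rank_of (multichain_poset rankP d) &
      forall m : nat, (1 <= m)%N ->
        #|{: multichain (m * d) P}| =
        #|{: multichain m (multichain_poset rankP d)}| ].
Proof.
case: d d_ge1 => // d _; split.
- case=> x [_ uniq_x].
  have bot_x y : x <= y by have [z /uniq_x <-] := minimal_below y.
  have bot b : (const_multichain d x : multichain_poset rankP d.+1) <= b.
    exact: const_multichain_le.
  exists (const_multichain d x); split=> [b le_b|b min_b].
    by apply/le_anti; rewrite le_b bot.
  exact: min_b.
- apply/eqP; rewrite eqn_leq; apply/andP; split.
    apply: (@rank_of_homo _ P (multichain_poset rankP d.+1) (const_multichain d)) => x y.
    rewrite !lt_neqAle => /andP[ne_xy le_xy]; apply/andP; split.
      apply: contra_neq ne_xy => /(congr1 (fun a : multichain d.+1 P => tnth a ord0)).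
      by rewrite !tnth_mktuple.
    by apply: const_multichain_le => j; rewrite tnth_mktuple.
  apply: (@rank_of_homo _ (multichain_poset rankP d.+1) P
            (fun a => tnth (mc_tuple a) ord_max)) => a b.
  by rewrite lt_neqAle => /andP[ne_ab le_ab]; apply: multichain_lt_top.
- case=> // m _; rewrite mulSn card_multichainD card_multichainS.
  by apply: eq_bigr => a _; rewrite extensions_top.
Qed.
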